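(* Let $d+1\le D$, $\mathcal{J}=\{1,\dots,d\}$, let $S=(S_1,\dots,S_d)$ be a $d$-dimensional subdivision, and let $S'=S+(d+1)=(S_1,\dots,S_d,S^0)$ be the $(d+1)$-dimensional subdivision obtained by adding the variable $d+1$ with minimal subdivision $S^0=\{-1,0,1,2\}$. For $\underline\ell\in\mathcal{L}_{S'}$, write $\underline\ell=(\widetilde{\underline\ell},\ell_{d+1})$ with $\widetilde{\underline\ell}\in\mathcal{L}_S$ and $\ell_{d+1}\in\{1,2\}$, and let $$\beta_{\underline\ell}=(\widehat\alpha_{\mathcal{J},S})_{\widetilde{\underline\ell}}-(\widehat\alpha_{\mathcal{J}\cup\{d+1\},S+(d+1)})_{\underline\ell}.$$ For $\underline\ell,\underline\ell'\in\mathcal{L}_{S'}$ define $\Psi_{\underline\ell,\underline\ell'}=\prod_{j=1}^{d+1}\psi^{(j)}_{\ell_j,\ell'_j}$ if $|\ell_j-\ell'_j|\le1$ for all $j=1,\dots,d+1$, and $\Psi_{\underline\ell,\underline\ell'}=0$ otherwise, where, for $|\ell_j-\ell'_j|\le1$, $$\psi^{(j)}_{\ell_j,\ell'_j}=\begin{cases}\frac{1}{3}\big(t^{(S'_j)}_{(\ell_j+1)}-t^{(S'_j)}_{(\ell_j)}\big)&\text{if }\ell_j=\ell'_j=1,\\ \frac13\big(t^{(S'_j)}_{(\ell_j)}-t^{(S'_j)}_{(\ell_j-1)}\big)&\text{if }\ell_j=\ell'_j=m_{S'_j},\\ \frac13\big(t^{(S'_j)}_{(\ell_j+1)}-t^{(S'_j)}_{(\ell_j-1)}\big)&\text{if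 }\ell_j=\ell'_j\in\{2,\dots,m_{S'_j}-1\},\\ \frac16\big(t^{(S'_j)}_{(\ell_j+1)}-t^{(S'_j)}_{(\ell_j)}\big)&\text{if }\ell'_j=\ell_j+1,\\ \frac16\big(t^{(S'_j)}_{(\ell_j)}-t^{(S'_j)}_{(\ell_j-1)}\big)&\text{if }\ell'_j=\ell_j-1.\end{cases}$$ Then $$\int_{[0,1]^{d+1}}\big(\widehat{Y}_{\mathcal{J},S}(x)-\widehat{Y}_{\mathcal{J}\cup\{d+1\},S+(d+1)}(x)\big)^2dx=\sum_{\underline\ell\in\mathcal{L}_{S'},\ \underline\ell'\in\mathcal{L}_{S'}}\beta_{\underline\ell}\,\Psi_{\underline\ell,\underline\ell'}\,\beta_{\underline\ell'},$$ where in the integral $\widehat{Y}_{\mathcal{J},S}$ is viewed as a function of $d+1$ variables not depending on $x_{d+1}$.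
   Context: Subdivisions: a one-dimensional subdivision is a finite set $S\subset\mathbb{R}$ with ordered elements $-1=t^{(S)}_{(0)}<0=t^{(S)}_{(1)}<\dots<t^{(S)}_{(m_S)}=1<t^{(S)}_{(m_S+1)}=2$. A $q$-dimensional subdivision is a vector $S=(S_1,\dots,S_q)$ of these; $\mathcal{L}_S=\prod_{i=1}^q\{1,\dots,m_{S_i}\}$, $A_S=\mathbb{R}^{\mathcal{L}_S}$, $t^{(S)}_{\underline\ell}=(t^{(S_1)}_{(\ell_1)},\dots,t^{(S_q)}_{(\ell_q)})$. Basis functions: for $u<v<w$, $\phi_{u,v,w}(t)=\frac{t-u}{v-u}$ for $u\le t\le v$, $\frac{w-t}{w-v}$ for $v\le t\le w$, $0$ otherwise; $\phi^{(S)}_{\underline\ell}(t)=\prod_{i=1}^q\phi_{t^{(S_i)}_{(\ell_i-1)},t^{(S_i)}_{(\ell_i)},t^{(S_i)}_{(\ell_i+1)}}(t_i)$ on $[0,1]^q$; $Y_{S,\alpha}=\sum_{\underline\ell\in\mathcal{L}_S}\alpha_{\underline\ell}\phi^{(S)}_{\underline\ell}$ for $\alpha\in A_S$. Mode: let $x_D^{(1)},\dots,x_D^{(n)}\in[0,1]^D$, $y_1,\dots,y_n\in\mathbb{R}$. For $\mathcal{K}=\{1,\dots,q\}$ (used with $q=d$ and $q=d+1$), let $x^{(i)}_{\mathcal{K}}$ be the vector of the first $q$ coordinates of $x_D^{(i)}$ (pairwise distinct for $q=d$), let $\mathcal{C}_D$ be a convex subset of $\mathcal{C}([0,1]^D,\mathbb{R})$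 closed for uniform convergence, $\mathcal{C}_{\mathcal{K}}$ the set of $g:[0,1]^q\to\mathbb{R}$ such that $x\in[0,1]^D\mapsto g(x_1,\dots,x_q)$ is in $\mathcal{C}_D$, $k_D$ a continuous covariance function on $[0,1]^D\times[0,1]^D$, $k_{\mathcal{K}}(u,v)=k_D((u,0),(v,0))$ (padding by zeros), and $k_{\mathcal{K}}(S,S)=[k_{\mathcal{K}}(t^{(S)}_{\underline\ell},t^{(S)}_{\underline\ell'})]_{\underline\ell,\underline\ell'\in\mathcal{L}_S}$, assumed invertible for every $q$-dimensional $S$. Then $\widehat\alpha_{\mathcal{K},S}=\mathrm{argmin}\{\alpha^\top k_{\mathcal{K}}(S,S)^{-1}\alpha:\ \alpha\in A_S,\ Y_{S,\alpha}\in\mathcal{C}_{\mathcal{K}},\ Y_{S,\alpha}(x^{(i)}_{\mathcal{K}})=y_i\text{ for }i=1,\dots,n\}$, the feasible set for $(\mathcal{J},S)$ being assumed non-empty, and $\widehat{Y}_{\mathcal{K},S}=Y_{S,\widehat\alpha_{\mathcal{K},S}}$. *)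

(* Defs.v *)
From HB Require Import structures.
From mathcomp Require Import all_boot all_order all_algebra.
From mathcomp Require Import all_classical all_reals all_analysis.

Set Implicit Arguments.
Unset Strict Implicit.
Unset Printing Implicit Defensive.

Import Order.TTheory GRing.Theory Num.Theory.
Import numFieldNormedType.Exports.

Local Open Scope classical_set_scope.
Local Open Scope ring_scope.

(* The library has no Lebesgue measure on R^q: it is built on q.-tuple R as
   the q-fold product of the one-dimensional one. *)

Definition tcons (R : realType) (q : nat)
    (p : measurableTypeR R * q.-tuple (measurableTypeR R)) :
  q.+1.-tuple (measurableTypeR R) := [tuple of p.1 :: p.2].

Lemma measurable_tcons (R : realType) (q : nat) :
  measurable_fun
    [set: (measurableTypeR R * q.-tuple (measurableTypeR R))%type] (@tcons R q).
Proof. by apply: (@measurable_cons _ _ _ _ fst q snd). Qed.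

Section lebesgue_cons.
Context (R : realType) (q : nat).
Variable mu : {sigma_finite_measure set (q.-tuple (measurableTypeR R)) -> \bar R}.

Definition lebesgue_cons : set (q.+1.-tuple (measurableTypeR R)) -> \bar R :=
  pushforward (lebesgue_measure \x mu)%E (@tcons R q).

Let pf : {measure set (q.+1.-tuple (measurableTypeR R)) -> \bar R} :=
  measure_function_pushforward__canonical__measure_function_Measure
    (lebesgue_measure \x mu)%E (@measurable_tcons R q).

HB.instance Definition _ := isMeasure.Build _ _ _ lebesgue_cons
  (measure0 pf) (measure_ge0 pf) (@measure_semi_sigma_additive _ _ _ pf).

Let lebesgue_cons_sigma_finite : sigma_finite setT lebesgue_cons.
Proof.
have /sigma_finiteP[F [FT ndF Foo]] := sigma_finiteT (@lebesgue_measure R).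
have /sigma_finiteP[G [GT ndG Goo]] := sigma_finiteT mu.
pose un (t : q.+1.-tuple (measurableTypeR R)) := (thead t, [tuple of behead t]).
have tK : cancel (@tcons R q) un.
  by case=> a t; rewrite /un /tcons theadE /=; congr pair; exact/val_inj.
have mun : measurable_fun setT un.
  by apply: measurable_fun_pair; [exact: measurable_tnth|exact: measurable_behead].
exists (fun i => un @^-1` (F i `*` G i)).
  rewrite -preimage_bigcup -[LHS](preimage_setT un); congr (_ @^-1` _).
  rewrite -setXTT FT GT; apply/seteqP; split=> [[x y]|[x y] [n _ []]] /=.
    move=> [[n _ Fnx] [k _ Gky]]; exists (maxn n k) => //; split.
    - by move: x Fnx; exact/subsetPset/ndF/leq_maxl.
    - by move: y Gky; exact/subsetPset/ndG/leq_maxr.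
  by split; exists n.
move=> i; have [mF Fi] := Foo i; have [mG Gi] := Goo i; split.
  by rewrite -[X in measurable X]setTI; apply: mun => //; exact: measurableX.
rewrite /lebesgue_cons /pushforward -comp_preimage.
rewrite (_ : un \o _ = id); last by apply/funext => p /=; rewrite tK.
by rewrite preimage_id product_measure1E// lte_mul_pinfty// ge0_fin_numE.
Qed.

HB.instance Definition _ := Measure_isSigmaFinite.Build _ _ _ lebesgue_cons
  lebesgue_cons_sigma_finite.

End lebesgue_cons.

Fixpoint lebesgue_tuple (R : realType) (q : nat) :
    {sigma_finite_measure set (q.-tuple (measurableTypeR R)) -> \bar R} :=
  match q with
  | 0%N => \d_[tuple]
  | q'.+1 => lebesgue_cons (lebesgue_tuple R q')
  end.

Lemma lebesgue_tuple_box (R : realType) (q : nat)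
    (A : 'I_q -> set (measurableTypeR R)) :
  (forall i, measurable (A i)) ->
  lebesgue_tuple R q [set t | forall i, A i (tnth t i)] =
  (\big[*%E/1]_(i < q) lebesgue_measure (A i))%E.
Proof.
elim: q A => [|q IH] A mA.
  by rewrite big_ord0 /= diracE mem_set //= => -[].
rewrite big_ord_recl -IH //= /lebesgue_cons /pushforward -product_measure1E //.
  congr (product_measure1 _ _ _); apply/seteqP; split=> [[a t] /= At|[a t] /= [Aa At] i].
    by split=> [|i]; [have := At ord0; rewrite tnth0|have := At (lift ord0 i); rewrite tnthS].
  by case: (unliftP ord0 i) => [j|] ->; rewrite ?tnthS ?tnth0 //.
rewrite (_ : [set _ | _] = \bigcap_(i in [set: 'I_q])
  ((fun t : q.-tuple (measurableTypeR R) => tnth t i) @^-1` A (lift ord0 i))).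
  apply: fin_bigcap_measurable; first exact: finite_finset.
  move=> i _; rewrite -[X in measurable X]setTI; exact: measurable_tnth.
by apply/seteqP; split=> t /= At i; [move=> _; exact: At|exact: (At i)].
Qed.

Definition tuple_row (R : realType) (q : nat)
  (t : q.-tuple (measurableTypeR R)) : 'rV[R]_q := \row_i tnth t i.

Definition unit_cube (R : realType) (q : nat) : set 'rV[R]_q :=
  [set x | forall i, 0 <= x 0 i <= 1].

(* The finite set is given by its increasing enumeration t_(0), ..., t_(m+1),
   with m = nlevels s; the boundary conditions force m >= 2. *)
Record subdivision (R : realType) := Subdivision {
  knots :> seq R;
  knots_sorted : sorted <%R knots;
  knots_first : knots`_0 = -1;
  knots_zero : knots`_1 = 0;
  knots_one : knots`_(size knots - 2) = 1;
  knots_last : knots`_(size knots - 1) = 2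
}.

Definition nlevels (R : realType) (s : subdivision R) : nat := (size s - 2)%N.

Section minimal_subdivision.
Variable R : realType.
Let ks : seq R := [:: -1; 0; 1; 2].
Let ks_sorted : sorted <%R ks.
Proof. by rewrite /= ltrN10 ltr01 ltr1n. Qed.

Definition min_subdivision : subdivision R :=
  @Subdivision R ks ks_sorted erefl erefl erefl erefl.
End minimal_subdivision.

(* The index set L_S; the component l i : 'I_m stands for the 1-based index
   (l i).+1 in {1, ..., m}. *)
Definition mindex (R : realType) (q : nat) (S : 'I_q -> subdivision R) : finType :=
  {dffun forall i : 'I_q, 'I_(nlevels (S i))}.

Definition knot_point (R : realType) (q : nat) (S : 'I_q -> subdivision R)
  (l : mindex S) : 'rV[R]_q := \row_i (S i)`_(l i).+1.

Definition hat (R : realType) (u v w t : R) : R :=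
  if u <= t <= v then (t - u) / (v - u)
  else if v <= t <= w then (w - t) / (w - v) else 0.

Definition basis_fun (R : realType) (q : nat) (S : 'I_q -> subdivision R)
    (l : mindex S) (x : 'rV[R]_q) : R :=
  \prod_(i < q) hat (S i)`_(l i) (S i)`_(l i).+1 (S i)`_(l i).+2 (x 0 i).

Definition interpolant (R : realType) (q : nat) (S : 'I_q -> subdivision R)
    (a : {ffun mindex S -> R}) (x : 'rV[R]_q) : R :=
  \sum_(l : mindex S) a l * basis_fun l x.

Definition covariance_on (R : realType) (T : Type) (A : set T)
    (k : T -> T -> R) : Prop :=
  (forall u v, A u -> A v -> k u v = k v u) /\
  (forall (n : nat) (p : 'I_n -> T) (c : 'I_n -> R), (forall i, A (p i)) ->
     0 <= \sum_(i < n) \sum_(j < n) c i * c j * k (p i) (p j)).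

Definition first_coords (R : realType) (q D : nat) (hq : (q <= D)%N)
  (x : 'rV[R]_D) : 'rV[R]_q := \row_(i < q) x 0 (widen_ord hq i).

Definition zero_pad (R : realType) (q D : nat) (u : 'rV[R]_q) : 'rV[R]_D :=
  \row_(j < D) (if insub (val j) is Some i then u 0 i else 0).

(* Functions on [0,1]^q are represented by functions on 'rV[R]_q.  The values
   outside the cube are irrelevant: a set that is closed for the uniform
   topology over the cube contains with f every g that agrees with f there. *)
Lemma closed_uniform_ext (R : realType) (q : nat)
    (C : set {uniform` @unit_cube R q -> R}) :
  closed C -> forall f g : 'rV[R]_q -> R,
  (forall x, unit_cube x -> f x = g x) -> C f -> C g.
Proof.
move=> cC f g fg Cf; apply: cC => P /uniform_nbhs[E [entE EP]].
exists f; split=> //; apply: EP => y cy /=; rewrite fg //; exact: entourage_refl.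
Qed.

Definition restrict_class (R : realType) (q D : nat) (hq : (q <= D)%N)
    (C : set ('rV[R]_D -> R)) : set ('rV[R]_q -> R) :=
  [set g | C (fun x => g (first_coords hq x))].

Definition kernel_restrict (R : realType) (q D : nat)
    (k : 'rV[R]_D -> 'rV[R]_D -> R) (u v : 'rV[R]_q) : R :=
  k (zero_pad D u) (zero_pad D v).

(* L_S is enumerated by enum_val in order to index rows and columns. *)
Definition kernel_matrix (R : realType) (q D : nat)
    (k : 'rV[R]_D -> 'rV[R]_D -> R) (S : 'I_q -> subdivision R) :
    'M[R]_#|mindex S| :=
  \matrix_(i, j) kernel_restrict k (knot_point (enum_val i)) (knot_point (enum_val j)).

Definition coef_vector (R : realType) (q : nat) (S : 'I_q -> subdivision R)
  (a : {ffun mindex S -> R}) : 'cV[R]_#|mindex S| := \col_i a (enum_val i).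

Definition energy (R : realType) (q D : nat)
    (k : 'rV[R]_D -> 'rV[R]_D -> R) (S : 'I_q -> subdivision R)
    (a : {ffun mindex S -> R}) : R :=
  ((coef_vector a)^T *m invmx (kernel_matrix k S) *m coef_vector a) 0 0.

Definition feasible (R : realType) (q D n : nat) (hq : (q <= D)%N)
    (C : set ('rV[R]_D -> R)) (x : 'I_n -> 'rV[R]_D) (y : 'I_n -> R)
    (S : 'I_q -> subdivision R) : set {ffun mindex S -> R} :=
  [set a | restrict_class hq C (interpolant a) /\
           forall i, interpolant a (first_coords hq (x i)) = y i].

Arguments energy {R q D} k S a.
Arguments feasible {R q D n} hq C x y S _.

Definition argmin_on (R : realType) (T : Type) (f : T -> R) (A : set T) : set T :=
  [set a | A a /\ forall b, A b -> f a <= f b].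

(* A positive definite quadratic form has exactly one minimizer on a non-empty
   closed convex set; xget selects it (0 is only the default of xget). *)
Definition mode_coef (R : realType) (q D n : nat) (hq : (q <= D)%N)
    (C : set ('rV[R]_D -> R)) (k : 'rV[R]_D -> 'rV[R]_D -> R)
    (x : 'I_n -> 'rV[R]_D) (y : 'I_n -> R) (S : 'I_q -> subdivision R) :
    {ffun mindex S -> R} :=
  xget [ffun=> 0] (argmin_on (energy k S) (feasible hq C x y S)).

Definition mode_fun (R : realType) (q D n : nat) (hq : (q <= D)%N)
    (C : set ('rV[R]_D -> R)) (k : 'rV[R]_D -> 'rV[R]_D -> R)
    (x : 'I_n -> 'rV[R]_D) (y : 'I_n -> R) (S : 'I_q -> subdivision R) :
    'rV[R]_q -> R :=
  interpolant (mode_coef hq C k x y S).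

Definition add_variable (R : realType) (d : nat) (S : 'I_d -> subdivision R) :
    'I_d.+1 -> subdivision R :=
  fun i => if unlift ord_max i is Some j then S j else min_subdivision R.

Lemma nlevels_add_variable (R : realType) (d : nat) (S : 'I_d -> subdivision R)
  (i : 'I_d) : nlevels (add_variable S (lift ord_max i)) = nlevels (S i).
Proof. by rewrite /add_variable liftK. Qed.

Definition drop_last (R : realType) (d : nat) (S : 'I_d -> subdivision R)
    (l : mindex (add_variable S)) : mindex S :=
  [ffun i : 'I_d => cast_ord (nlevels_add_variable S i) (l (lift ord_max i))].

(* Indices l, l' are 1-based here. *)
Definition psi (R : realType) (s : subdivision R) (l l' : nat) : R :=
  if (l == 1%N) && (l' == 1%N) then 3^-1 * (s`_l.+1 - s`_l)
  else if (l == nlevels s) && (l' == nlevels s) then 3^-1 * (s`_l - s`_l.-1)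
  else if l == l' then 3^-1 * (s`_l.+1 - s`_l.-1)
  else if l' == l.+1 then 6^-1 * (s`_l.+1 - s`_l)
  else if l == l'.+1 then 6^-1 * (s`_l - s`_l.-1)
  else 0.

Definition Psi (R : realType) (q : nat) (S : 'I_q -> subdivision R)
    (l l' : mindex S) : R :=
  if [forall j, (`|(l j : nat) - (l' j : nat)| <= 1)%N]
  then \prod_(j < q) psi (S j) (l j).+1 (l' j).+1 else 0.

(* Main.v *)
Require Import Defs.
From HB Require Import structures.
From mathcomp Require Import all_boot all_order all_algebra.
From mathcomp Require Import all_classical all_reals all_analysis.
From mathcomp Require Import measurable_realfun ring lra zify.

Set Implicit Arguments.
Unset Strict Implicit.
Unset Printing Implicit Defensive.

Import Order.TTheory GRing.Theory Num.Theory.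
Import numFieldNormedType.Exports.

Local Open Scope classical_set_scope.
Local Open Scope ring_scope.

(** The identity computes an L^2 norm in the basis of tensor-product hat
    functions, once both modes are written in the basis of the same
    subdivision S'.

    The two hat functions of the minimal subdivision add up to 1 on [0,1].
    Repeating a coefficient vector over the two levels of
    the new variable therefore leaves the interpolated function unchanged on
    the cube ([interpolant_add_variable]), and the difference of the two modes
    is the interpolant of beta on S'.

    The integral of the square of an interpolant is the quadratic form of the
    Gram matrix of the basis functions ([integral_interpolant_sqr]).  As a
    basis function is a product of functions of one variable each, Tonelli's
    theorem makes a Gram entry the product over the variables of
    one-dimensional Gram entries ([integral_lebesgue_tuple_prod]).

    The one-dimensional entries are assembled cell by cell, as in the finite
    element method ([integral_tentM]).  Between two consecutive knots at
    distance h each hat function is affine, and the product of two affine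
    functions with end values f0, f1 and g0, g1 integrates to
    h/6 (2 f0 g0 + f0 g1 + f1 g0 + 2 f1 g1) ([integral_affineM]).  A hat
    function has the value 1 at its own knot and 0 at the others, so at most
    two cells contribute to a given entry, and their contributions add up to
    psi ([psiE]). *)

(** * Hat functions *)

(** The closed form by maximum and minimum makes nonnegativity and
    measurability immediate. *)
Lemma hatE (R : realType) (u v w t : R) : u < v -> v < w ->
  hat u v w t = Num.max 0 (Num.min ((t - u) / (v - u)) ((w - t) / (w - v))).
Proof.
move=> uv vw; rewrite /hat.
have vu0 : 0 < v - u by rewrite subr_gt0.
have wv0 : 0 < w - v by rewrite subr_gt0.
have l0 : (0 <= (t - u) / (v - u)) = (u <= t).
  by rewrite pmulr_lge0 ?invr_gt0 // subr_ge0.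
have r0 : (0 <= (w - t) / (w - v)) = (t <= w).
  by rewrite pmulr_lge0 ?invr_gt0 // subr_ge0.
have [tv|vt] := leP t v.
  have l1 : (t - u) / (v - u) <= 1 by rewrite ler_pdivrMr // mul1r; lra.
  have r1 : 1 <= (w - t) / (w - v) by rewrite ler_pdivlMr // mul1r; lra.
  rewrite (min_idPl (le_trans l1 r1)) andbT; case: ifPn => ut.
    by rewrite (max_idPr _) // l0.
  rewrite ifF; last by apply/negbTE; lra.
  by rewrite (max_idPl _) // leNgt; apply: contraNN ut => /ltW; rewrite l0.
have l1 : 1 <= (t - u) / (v - u) by rewrite ler_pdivlMr // mul1r; lra.
have r1 : (w - t) / (w - v) <= 1 by rewrite ler_pdivrMr // mul1r; lra.
rewrite (min_idPr (le_trans r1 l1)) andbF (ltW vt) /=; case: ifPn => tw.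
  by rewrite (max_idPr _) // r0.
by rewrite (max_idPl _) // leNgt; apply: contraNN tw => /ltW; rewrite r0.
Qed.

Lemma hat_ge0 (R : realType) (u v w t : R) : u < v -> v < w -> 0 <= hat u v w t.
Proof. by move=> uv vw; rewrite hatE // le_max lexx. Qed.

Lemma measurable_hat (R : realType) (u v w : R) : u < v -> v < w ->
  measurable_fun [set: R] (hat u v w).
Proof.
move=> uv vw; rewrite (_ : hat u v w = fun t =>
    Num.max 0 (Num.min ((t - u) / (v - u)) ((w - t) / (w - v)))); last first.
  by apply/funext => t; exact: hatE.
apply: measurable_maxr; first exact: measurable_cst.
by apply: measurable_minr; apply: measurable_funM => //; apply: measurable_funB.
Qed.

Lemma hat_up (R : realType) (u v w t : R) : u <= t <= v ->
  hat u v w t = (t - u) / (v - u).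
Proof. by rewrite /hat => ->. Qed.

Lemma hat_down (R : realType) (u v w t : R) : u < v -> v < w -> v <= t <= w ->
  hat u v w t = (w - t) / (w - v).
Proof.
move=> uv vw /andP[vt tw]; rewrite /hat vt tw.
case: ifP => // /andP[_ tv]; have -> : t = v by apply/eqP; rewrite eq_le tv.
by rewrite !divff // gt_eqF // subr_gt0.
Qed.

Lemma hat_out (R : realType) (u v w t : R) : (t <= u) || (w <= t) ->
  u < v -> v < w -> hat u v w t = 0.
Proof.
move=> /orP[tu|wt] uv vw; rewrite /hat.
  case: ifP => [/andP[ut _]|_].
    by have -> : t = u by [apply/eqP; rewrite eq_le tu]; rewrite subrr mul0r.
  by case: ifP => // /andP[vt _]; exfalso; lra.
case: ifP => [/andP[_ tv]|_]; first by exfalso; lra.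
case: ifP => // /andP[_ tw].
by have -> : t = w by [apply/eqP; rewrite eq_le wt tw]; rewrite subrr mul0r.
Qed.

(** * Integration over consecutive cells *)

Lemma integral_poly (R : realType) (p : {poly R}) (a b : R) : a < b ->
  (\int[lebesgue_measure]_(x in `[a, b]) (p^`().[x])%:E = (p.[b] - p.[a])%:E)%E.
Proof.
move=> ab; rewrite EFinB.
apply: (@continuous_FTC2 _ (horner p^`()) (horner p)) => //.
- by apply: continuous_subspaceT => x; exact: continuous_horner.
- split.
  + by move=> x _; exact: derivable_horner.
  + by apply: cvg_at_right_filter; exact: continuous_horner.
  + by apply: cvg_at_left_filter; exact: continuous_horner.
- by move=> x _; rewrite derivE.
Qed.

(** With s = x - a and df, dg the slopes, the product is
    (f0 + df s)(g0 + dg s); the proof integrates this polynomial in s. *)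
Lemma integral_affineM (R : realType) (f g : R -> R) (a b f0 f1 g0 g1 : R) :
  a < b ->
  {in `[a, b], forall x, f x = ((b - x) * f0 + (x - a) * f1) / (b - a)} ->
  {in `[a, b], forall x, g x = ((b - x) * g0 + (x - a) * g1) / (b - a)} ->
  (\int[lebesgue_measure]_(x in `[a, b]) (f x * g x)%:E =
   (6^-1 * (b - a) * (2 * f0 * g0 + f0 * g1 + f1 * g0 + 2 * f1 * g1))%:E)%E.
Proof.
move=> ab fE gE; have h0 : b - a != 0 by rewrite gt_eqF // subr_gt0.
pose s : {poly R} := 'X - a%:P.
pose df := (f1 - f0) / (b - a); pose dg := (g1 - g0) / (b - a).
pose p := (f0 * g0) *: s + ((f0 * dg + g0 * df) / 2) *: s ^+ 2 +
          (df * dg / 3) *: s ^+ 3.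
have pE z : p.[z] = (f0 * g0) * (z - a)
    + ((f0 * dg + g0 * df) / 2) * (z - a) ^+ 2 + (df * dg / 3) * (z - a) ^+ 3.
  by rewrite /p /s !(hornerD, hornerZ, horner_exp, hornerN, hornerX, hornerC).
rewrite (_ : 6^-1 * _ * _ = p.[b] - p.[a]); last first.
  by rewrite !pE /df /dg; field.
rewrite -integral_poly //; apply: eq_integral => x; rewrite inE /= => xab.
congr EFin; rewrite fE // gE // /p /s !poly.derivE /=.
rewrite !(hornerD, hornerZ, hornerM, hornerN, hornerX, hornerC) /df /dg.
by field.
Qed.

Lemma ge0_integral_itv_cat (R : realType) (f : R -> \bar R) (a b c : R) :
  a <= b -> b <= c -> measurable_fun setT f -> (forall x, 0 <= f x)%E ->
  (\int[lebesgue_measure]_(x in `[a, c]) f x =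
   \int[lebesgue_measure]_(x in `[a, b]) f x +
   \int[lebesgue_measure]_(x in `[b, c]) f x)%E.
Proof.
move=> ab bc mf f0.
rewrite (@itv_bndbnd_setU _ _ _ (BLeft b)) ?bnd_simp //.
rewrite ge0_integral_setU //=.
- by rewrite integral_itv_bndo_bndc //; exact: measurable_funTS.
- exact: measurable_funTS.
- apply/disj_setPS => y [/=]; rewrite 2!in_itv/= => /andP[_ yx] /andP[].
  by rewrite leNgt yx.
Qed.

Lemma ge0_integral_itv_cells (R : realType) (f : R -> \bar R) (p : nat -> R) n :
  (forall i, (i < n)%N -> p i <= p i.+1) ->
  measurable_fun setT f -> (forall x, 0 <= f x)%E ->
  (\int[lebesgue_measure]_(x in `[p 0%N, p n]) f x =
   \sum_(i < n) \int[lebesgue_measure]_(x in `[p i, p i.+1]) f x)%E.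
Proof.
move=> + mf f0; elim: n => [|n IH] ple.
  by rewrite big_ord0 set_itv1 integral_set1.
rewrite big_ord_recr /= -IH => [|i /ltnW]; last exact: ple.
rewrite -ge0_integral_itv_cat // ?ple //.
suff: forall k, (k <= n)%N -> p 0%N <= p k by apply.
elim=> // k IHk kn; apply: le_trans (IHk (ltnW kn)) _; apply: ple.
exact: ltnW.
Qed.

(** * The one-dimensional Gram matrix *)

Section knots.
Variables (R : realType) (s : subdivision R).
Local Notation m := (nlevels s).

(** With fewer than two levels the knot prescribed to be 1 would be the first
    one, -1, or the second one, 0. *)
Lemma nlevels_gt1 : (1 < m)%N.
Proof.
have := knots_one s; rewrite -/(nlevels s); case: (nlevels s) => [|[|k]] //.
  by rewrite knots_first => h; have := ltrN10 R; rewrite h ltr10.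
by rewrite knots_zero => /eqP; rewrite eq_sym oner_eq0.
Qed.

Lemma size_knots : size s = m.+2.
Proof.
have := nlevels_gt1; rewrite /nlevels; case: (size s) => [|[|k]] //.
by rewrite subSS subn1.
Qed.

Lemma ltr_knots i j : (i < j)%N -> (j < m.+2)%N -> s`_i < s`_j.
Proof.
move=> ij jm; apply: (sorted_ltn_nth lt_trans 0 (knots_sorted s)) => //.
all: rewrite inE size_knots //; exact: ltn_trans jm.
Qed.

Lemma ler_knots i j : (i <= j)%N -> (j < m.+2)%N -> s`_i <= s`_j.
Proof.
by rewrite leq_eqVlt => /predU1P[-> //|ij] jm; apply/ltW/ltr_knots.
Qed.

(** The levels count from 0 here, as in [mindex]: [tent l] peaks at the knot of
    index l.+1. *)
Definition tent (l : nat) (t : R) : R := hat s`_l s`_l.+1 s`_l.+2 t.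

Lemma tent_ge0 l t : (l < m)%N -> 0 <= tent l t.
Proof.
by move=> lm; apply: hat_ge0; apply: ltr_knots; rewrite // ltnS ltnW.
Qed.

Lemma measurable_tent l : (l < m)%N -> measurable_fun [set: R] (tent l).
Proof.
by move=> lm; apply: measurable_hat; apply: ltr_knots; rewrite // ltnS ltnW.
Qed.

(** The cells of [0,1] are the intervals from s`_j.+1 to s`_j.+2 with
    j.+1 < m; the two deltas are the values at the end points of the cell. *)
Lemma tent_cell l j : (l < m)%N -> (j.+1 < m)%N ->
  {in `[s`_j.+1, s`_j.+2], forall t, tent l t =
    ((s`_j.+2 - t) * (l == j)%:R + (t - s`_j.+1) * (l == j.+1)%:R)
      / (s`_j.+2 - s`_j.+1)}.
Proof.
move=> lm jm t; rewrite in_itv /= => /andP[jt tj].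
have uv : s`_l < s`_l.+1 by apply: ltr_knots; rewrite // ltnS ltnW.
have vw : s`_l.+1 < s`_l.+2 by apply: ltr_knots.
have [lj|jl|lj] := ltngtP l j.
- rewrite (ltn_eqF (ltn_trans lj (leqnn _))) !mulr0 addr0 mul0r.
  apply: hat_out => //; apply/orP; right; apply: le_trans jt.
  by apply: ler_knots => //; rewrite ltnS ltnW // ltnW.
- have [lj|jl1|->] := ltngtP l j.+1.
  + by move: lj; rewrite ltnS leqNgt jl.
  + rewrite !mulr0 addr0 mul0r; apply: hat_out => //; apply/orP; left.
    apply: le_trans tj _; apply: ler_knots => //; lia.
  + rewrite mulr0 add0r mulr1; apply: hat_up; exact/andP.
- move: uv vw; rewrite lj ltn_eqF // mulr1 mulr0 addr0 => uv vw.
  by apply: hat_down => //; exact/andP.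
Qed.

Lemma sum_delta (n k : nat) (F : nat -> R) :
  \sum_(i < n) (k == i)%:R * F i = if (k < n)%N then F k else 0.
Proof.
case: ltnP => [kn|nk].
  rewrite (bigD1 (Ordinal kn)) //=  eqxx mul1r big1 ?addr0 // => i.
  by rewrite -val_eqE /= eq_sym => /negbTE ->; rewrite mul0r.
by rewrite big1 // => i _; rewrite gtn_eqF ?mul0r // (leq_trans _ nk).
Qed.

(** Assembly of psi from the element matrices h/6 (2, 1; 1, 2).  The boundary
    cases of psi are those where one of the two neighbouring cells lies
    outside [0,1] and is absent from the sum. *)
Lemma psiE l l' : (l < m)%N -> (l' < m)%N ->
  psi s l.+1 l'.+1 = \sum_(i < m.-1) 6^-1 * (s`_i.+2 - s`_i.+1) *
    (2 * (l == i)%:R * (l' == i)%:R + (l == i)%:R * (l' == i.+1)%:R +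
     (l == i.+1)%:R * (l' == i)%:R + 2 * (l == i.+1)%:R * (l' == i.+1)%:R).
Proof.
move=> lm lm'; have m1 := nlevels_gt1.
(* X i and Z i gather what cell i contributes to level l when the knot of l is
   the left, respectively the right, end of that cell. *)
pose X i := 6^-1 * (s`_i.+2 - s`_i.+1) * (2 * (l' == i)%:R + (l' == i.+1)%:R).
pose Z i := 6^-1 * (s`_i.+2 - s`_i.+1) * ((l' == i)%:R + 2 * (l' == i.+1)%:R).
under eq_bigr => i _.
  rewrite (_ : _ * _ = (l == i)%:R * X i + (l == i.+1)%:R * Z i); last first.
    by rewrite /X /Z; ring.
  over.
rewrite big_split /= sum_delta.
have -> : \sum_(i < m.-1) (l == i.+1)%:R * Z i =
          if (0 < l)%N then Z l.-1 else 0.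
  case: l lm => [|l] lm /=; first by rewrite big1 // => i _; rewrite mul0r.
  under eq_bigr do rewrite eqSS.
  by rewrite sum_delta ifT //; lia.
rewrite /psi {}/X {}/Z !eqSS.
have [<-{l' lm'}|ll'] := eqVneq l l'.
  rewrite !andbb; have -> : (l.+1 == m) = ~~ (l < m.-1)%N by lia.
  have -> : (l == l.+1) = false by lia.
  case: l lm => [|l] lm /=.
    by rewrite ifT; [field|lia].
  have -> : (l.+1 == l) = false by lia.
  by rewrite eqxx; case: ltnP => _ /=; field.
have -> : (l == 0%N) && (l' == 0%N) = false by lia.
have -> : (l.+1 == m) && (l'.+1 == m) = false by lia.
have [l'E|l'l] := eqVneq l' l.+1.
  have -> : (l < m.-1)%N by lia.
  have -> : (l' == l.-1) = false by lia.
  case: (posnP l) => [_|l0]; first by rewrite /=; field.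
  by have -> : (l' == l.-1.+1) = false; [lia|rewrite /=; field].
have [lE|ll] := eqVneq l l'.+1.
  by rewrite lE /= eqxx ltn_eqF //; case: ifP => _; rewrite /=; field.
have -> : (l' == l.-1) = false by lia.
case: (posnP l) => [_|l0]; first by case: ifP => _; rewrite /=; field.
have -> : (l' == l.-1.+1) = false by lia.
by case: ifP => _; rewrite /=; field.
Qed.

Lemma integral_tentM l l' : (l < m)%N -> (l' < m)%N ->
  (\int[lebesgue_measure]_(t in `[0%R, 1%R]) (tent l t * tent l' t)%:E =
   (psi s l.+1 l'.+1)%:E)%E.
Proof.
move=> lm lm'; have m1 := nlevels_gt1.
(* The end points 0 and 1 become the knots of indices 1 and m.-1.+1, so that
   [0,1] is the union of m.-1 cells. *)
rewrite -(knots_zero s) -(knots_one s) -/(nlevels s) -{1}(ltn_predK m1).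
rewrite (@ge0_integral_itv_cells _ _ (fun i => s`_i.+1)); last 3 first.
- by move=> i im; apply: ler_knots => //; lia.
- apply/measurable_EFinP; apply: measurable_funM; exact: measurable_tent.
- by move=> t; rewrite lee_fin mulr_ge0 // tent_ge0.
rewrite psiE // -sumEFin; apply: eq_bigr => i _.
have im : (i.+1 < m)%N by have := ltn_ord i; lia.
apply: integral_affineM; [|exact: tent_cell..].
by apply: ltr_knots => //; lia.
Qed.
End knots.

(** * Product functions on the cube *)

Lemma measurable_prod_tnth (R : realType) (q : nat) (h : 'I_q -> R -> R) :
  (forall i, measurable_fun [set: R] (h i)) ->
  measurable_fun [set: q.-tuple (measurableTypeR R)]
    (fun t => \prod_(i < q) h i (tnth t i)).
Proof.
move=> mh; apply: measurable_prod => i _.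
exact: (measurableT_comp (mh i) (@measurable_tnth _ (measurableTypeR R) q i)).
Qed.

(** By induction on q: Tonelli's theorem splits off the first coordinate, whose
    factor comes out of the inner integral. *)
Lemma integral_lebesgue_tuple_prod (R : realType) (q : nat) (g : 'I_q -> R -> R)
    (c : 'I_q -> R) :
  (forall i, measurable_fun [set: R] (g i)) -> (forall i x, 0 <= g i x) ->
  (forall i, \int[lebesgue_measure]_x (g i x)%:E = (c i)%:E)%E ->
  (\int[lebesgue_tuple R q]_t (\prod_(i < q) g i (tnth t i))%:E =
   (\prod_(i < q) c i)%:E)%E.
Proof.
elim: q g c => [|q IH] g c mg g0 gE.
  rewrite big_ord0 integral_dirac //=; last first.
    by apply/measurable_EFinP; exact: measurable_prod_tnth.
  by rewrite diracE mem_set // mul1e big_ord0.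
rewrite /= /lebesgue_cons ge0_integral_pushforward //=; first last.
- by move=> t _; rewrite lee_fin prodr_ge0.
- by apply/measurable_EFinP; exact: measurable_prod_tnth.
- exact: measurable_tcons.
rewrite preimage_setT fubini_tonelli1 /=; first last.
- by move=> t; rewrite lee_fin prodr_ge0.
- apply/measurable_EFinP; apply: (@measurableT_comp _ _ _ _ _ _
     (fun t : q.+1.-tuple (measurableTypeR R) =>
        \prod_(i < q.+1) g i (tnth t i))).
    exact: measurable_prod_tnth.
  exact: measurable_tcons.
rewrite /fubini_F /=.
have inner a : (\int[lebesgue_tuple R q]_t
    (\prod_(i < q.+1) g i (tnth (tcons (a, t)) i))%:E =
    (g ord0 a)%:E * (\prod_(i < q) c (lift ord0 i))%:E)%E.
  under eq_integral => t _.
    rewrite big_ord_recl /= tnth0 EFinM.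
    under eq_bigr do rewrite tnthS.
    over.
  rewrite /= ge0_integralZl_EFin //; first last.
  - apply/measurable_EFinP.
    exact: (@measurable_prod_tnth _ _ (fun i => g (lift ord0 i))).
  - by move=> t _; rewrite lee_fin prodr_ge0.
  by rewrite (IH (fun i => g (lift ord0 i)) (fun i => c (lift ord0 i))).
under eq_integral => a _ do rewrite inner.
rewrite ge0_integralZr //; first last.
- rewrite lee_fin prodr_ge0 // => i _; rewrite -lee_fin -gE integral_ge0 // => x _.
  by rewrite lee_fin.
- by move=> a _; rewrite lee_fin.
- by apply/measurable_EFinP; exact: mg.
by rewrite gE big_ord_recl EFinM.
Qed.

(** * The Gram matrix of the basis functions *)

(** Where Psi is cut off to 0, the product has a factor psi at two levels that
    are not neighbours, and that factor is 0. *)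
Lemma PsiE (R : realType) (q : nat) (S : 'I_q -> subdivision R)
    (l l' : mindex S) :
  Psi l l' = \prod_(j < q) psi (S j) (l j).+1 (l' j).+1.
Proof.
rewrite /Psi; case: ifPn => // /forallPn[j far]; symmetry; apply/eqP.
rewrite prodf_seq_eq0; apply/hasP; exists j; first exact: mem_index_enum.
have lj := ltn_ord (l j); have lj' := ltn_ord (l' j).
rewrite /= /psi !eqSS.
move: (nat_of_ord (l j)) (nat_of_ord (l' j)) far lj lj' => a b far aj bj.
rewrite !ifF //; lia.
Qed.

Lemma tuple_row_cubeE (R : realType) (q : nat) :
  @tuple_row R q @^-1` @unit_cube R q =
  [set t | forall i, tnth t i \in `[0, 1]].
Proof.
by apply/seteqP; split => t /= h i; have := h i; rewrite mxE in_itv.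
Qed.

Lemma measurable_cube (R : realType) (q : nat) :
  measurable (@tuple_row R q @^-1` @unit_cube R q).
Proof.
rewrite tuple_row_cubeE (_ : [set _ | _] = \bigcap_(i in [set: 'I_q])
  ((fun t : q.-tuple (measurableTypeR R) => tnth t i) @^-1` `[0, 1])).
  apply: fin_bigcap_measurable; first exact: finite_finset.
  move=> i _; rewrite -[X in measurable X]setTI; exact: measurable_tnth.
by apply/seteqP; split=> t /= h i; [move=> _; exact: h|exact: (h i)].
Qed.

(** The cube is a product set, so its indicator can be absorbed into the
    factors, which reduces the integral to one over the whole space. *)
Lemma integral_cube_prod (R : realType) (q : nat) (g : 'I_q -> R -> R)
    (c : 'I_q -> R) :
  (forall i, measurable_fun [set: R] (g i)) -> (forall i x, 0 <= g i x) ->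
  (forall i,
     \int[lebesgue_measure]_(x in `[0%R, 1%R]) (g i x)%:E = (c i)%:E)%E ->
  (\int[lebesgue_tuple R q]_(t in @tuple_row R q @^-1` @unit_cube R q)
     (\prod_(i < q) g i (tuple_row t 0 i))%:E = (\prod_(i < q) c i)%:E)%E.
Proof.
move=> mg g0 gE.
rewrite -(@integral_lebesgue_tuple_prod _ _ (fun i x => g i x * \1_`[0, 1] x)).
- rewrite integral_mkcond; apply: eq_integral => t _.
  rewrite patchE tuple_row_cubeE; case: ifPn => [|/negP].
    rewrite inE /= => h; congr EFin; apply: eq_bigr => i _.
    by rewrite mxE indicE mem_set ?mulr1 //=; exact: h.
  rewrite inE /= => /existsNP[i hi]; congr EFin; symmetry; apply/eqP.
  rewrite prodf_seq_eq0; apply/hasP; exists i; first exact: mem_index_enum.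
  by rewrite /= indicE memNset ?mulr0.
- by move=> i; apply: measurable_funM => //; exact: measurable_indic.
- by move=> i x; rewrite mulr_ge0.
- move=> i; rewrite -gE [RHS]integral_mkcond; apply: eq_integral => x _.
  by rewrite patchE indicE; case: ifP => _; rewrite ?mulr1 ?mulr0.
Qed.

Section gram.
Variables (R : realType) (q : nat) (S : 'I_q -> subdivision R).
Local Notation mu := (lebesgue_tuple R q).
Local Notation cube := (@tuple_row R q @^-1` @unit_cube R q).

Lemma measurable_basis_fun (l : mindex S) :
  measurable_fun [set: q.-tuple (measurableTypeR R)]
    (fun t => basis_fun l (tuple_row t)).
Proof.
have ms i := measurable_tent (ltn_ord (l i)).
under eq_fun => t.
  rewrite /basis_fun; under eq_bigr do rewrite mxE.
  over.
exact: measurable_prod_tnth ms.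
Qed.

Lemma integral_basis_funM (l l' : mindex S) :
  (\int[mu]_(t in cube)
     (basis_fun l (tuple_row t) * basis_fun l' (tuple_row t))%:E
   = (Psi l l')%:E)%E.
Proof.
rewrite PsiE.
rewrite -(@integral_cube_prod _ _
  (fun i x => tent (S i) (l i) x * tent (S i) (l' i) x)).
- by apply: eq_integral => t _; rewrite -big_split.
- by move=> i; apply: measurable_funM; exact: measurable_tent.
- by move=> i x; rewrite mulr_ge0 // tent_ge0.
- by move=> i; rewrite integral_tentM.
Qed.

Lemma integrable_basis_funM (l l' : mindex S) :
  mu.-integrable cube
    (fun t => (basis_fun l (tuple_row t) * basis_fun l' (tuple_row t))%:E).
Proof.
apply/integrableP; split.
  apply: measurable_funTS; apply/measurable_EFinP.
  by apply: measurable_funM; exact: measurable_basis_fun.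
under eq_integral => t _.
  rewrite gee0_abs; last by rewrite lee_fin mulr_ge0 // prodr_ge0 // => i _;
    exact: tent_ge0.
  over.
by rewrite integral_basis_funM ltry.
Qed.

Lemma integral_interpolant_sqr (a : {ffun mindex S -> R}) :
  (\int[mu]_(t in cube) (interpolant a (tuple_row t) ^+ 2)%:E =
   (\sum_l \sum_l' a l * Psi l l' * a l')%:E)%E.
Proof.
have mcube := @measurable_cube R q.
under eq_integral => t _.
  rewrite expr2 /interpolant mulr_suml -sumEFin.
  under eq_bigr => l _.
    rewrite mulr_sumr -sumEFin.
    under eq_bigr => l' _.
      rewrite (_ : (_ * _)%:E = ((a l * a l')%:E *
        (basis_fun l (tuple_row t) * basis_fun l' (tuple_row t))%:E)%E); last first.
        by rewrite -EFinM; congr EFin; ring.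
      over.
    over.
  over.
have int2 l l' := integrableZl mcube (a l * a l') (integrable_basis_funM l l').
rewrite integral_sum //= => [|l]; last exact: integrable_sum.
rewrite -sumEFin; apply: eq_bigr => l _.
rewrite integral_sum //= -sumEFin; apply: eq_bigr => l' _.
rewrite integralZl //; last exact: integrable_basis_funM.
by rewrite integral_basis_funM -EFinM; congr EFin; ring.
Qed.
End gram.

(** * Adding a variable with the minimal subdivision *)

Section add_variable.
Variables (R : realType) (d : nat) (S : 'I_d -> subdivision R).
Local Notation S' := (add_variable S).

Lemma add_variable_max : S' ord_max = min_subdivision R.
Proof. by rewrite /add_variable unlift_none. Qed.

Lemma add_variable_lift i : S' (lift ord_max i) = S i.
Proof. by rewrite /add_variable liftK. Qed.

Lemma nlevels_add_variable_max : nlevels (S' ord_max) = 2%N.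
Proof. by rewrite add_variable_max. Qed.

Definition last_level (l : mindex S') : 'I_2 :=
  cast_ord nlevels_add_variable_max (l ord_max).

(** The type of the level at coordinate i depends on i.  Its value is defined
    as a natural number first, so that the bound is a separate fact and no
    cast along an equality of types is needed. *)
Definition add_level_nat (l : mindex S) (e : 'I_2) (i : 'I_d.+1) : nat :=
  if unlift ord_max i is Some j then l j else e.

Fact add_level_subproof (l : mindex S) (e : 'I_2) i :
  (add_level_nat l e i < nlevels (S' i))%N.
Proof. by rewrite /add_level_nat /add_variable; case: unlift => [j|]. Qed.

Definition add_level (p : mindex S * 'I_2) : mindex S' :=
  [ffun i : 'I_d.+1 => Ordinal (add_level_subproof p.1 p.2 i)].

Lemma add_levelK : cancel add_level (fun l => (drop_last l, last_level l)).
Proof.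
move=> [l e]; congr pair.
  by apply/ffunP => i; apply: val_inj; rewrite !ffunE /= /add_level_nat liftK.
by apply: val_inj; rewrite /= ffunE /= /add_level_nat unlift_none.
Qed.

Lemma drop_lastK : cancel (fun l => (drop_last l, last_level l)) add_level.
Proof.
move=> l; apply/ffunP => i; apply: val_inj; rewrite ffunE /= /add_level_nat.
by case: unliftP => [j|] -> /=; rewrite ?ffunE.
Qed.

Lemma basis_fun_add_variable (l : mindex S') (x : 'rV[R]_d.+1) :
  basis_fun l x = basis_fun (drop_last l) (first_coords (leqnSn d) x) *
                  tent (min_subdivision R) (last_level l) (x 0 ord_max).
Proof.
rewrite /basis_fun (bigD1 ord_max) //= mulrC; congr (_ * _); last first.
  by rewrite -add_variable_max.
rewrite (reindex_omap (lift ord_max) (unlift ord_max)) /=; last first.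
  by move=> i; case: unliftP => [j|] -> //; rewrite eqxx.
apply: eq_big => [i|i _]; first by rewrite liftK eqxx eq_sym neq_lift.
rewrite mxE ffunE /= -(add_variable_lift i); congr (hat _ _ _ (x 0 _)).
by apply: val_inj; exact: lift_max.
Qed.

(** The two hat functions are 1 - t and t on [0,1]. *)
Lemma sum_tent_min (t : R) : 0 <= t <= 1 ->
  \sum_(e < 2) tent (min_subdivision R) e t = 1.
Proof.
move=> t01; rewrite big_ord_recl big_ord1 /tent /=.
by rewrite hat_down ?hat_up ?ltrN10 //; field.
Qed.

(** Summing over the level of the new variable first leaves the factor 1 in
    front of each coefficient. *)
Lemma interpolant_add_variable (a : {ffun mindex S -> R}) (x : 'rV[R]_d.+1) :
  0 <= x 0 ord_max <= 1 ->
  interpolant a (first_coords (leqnSn d) x) =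
  interpolant [ffun l : mindex S' => a (drop_last l)] x.
Proof.
move=> x01; rewrite /interpolant.
rewrite [RHS](reindex add_level) /=; last first.
  exact/onW_bij/(Bijective add_levelK drop_lastK).
under [RHS]eq_bigr => p _.
  rewrite ffunE basis_fun_add_variable.
  have [-> ->] : drop_last (add_level p) = p.1 /\
                 last_level (add_level p) = p.2.
    by have := add_levelK p; case: p => l e [-> ->].
  over.
rewrite -(pair_bigA _ (fun l (e : 'I_2) => a l *
  (basis_fun l (first_coords (leqnSn d) x) *
   tent (min_subdivision R) e (x 0 ord_max)))) /=.
by apply: eq_bigr => l _; rewrite -!mulr_sumr sum_tent_min // mulr1.
Qed.
End add_variable.

Lemma interpolantB (R : realType) (q : nat) (S : 'I_q -> subdivision R)
    (a b : {ffun mindex S -> R}) (x : 'rV[R]_q) :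
  interpolant a x - interpolant b x = interpolant [ffun l => a l - b l] x.
Proof.
by rewrite /interpolant -sumrB; apply: eq_bigr => l _; rewrite ffunE mulrBl.
Qed.

Theorem proposition4
  (R : realType) (d D n : nat) (hd : (d < D)%N)
  (x : 'I_n -> 'rV[R]_D) (y : 'I_n -> R)
  (hx : forall i, unit_cube (x i))
  (hx_inj : injective (fun i => first_coords (ltnW hd) (x i)))
  (C : set {uniform` @unit_cube R D -> R})
  (hC_cont : C `<=` [set f | {within @unit_cube R D, continuous f}])
  (hC_convex : convex_set (C : set (convex_lmodType ('rV[R]_D -> R^o))))
  (hC_closed : closed C)
  (k : 'rV[R]_D -> 'rV[R]_D -> R)
  (hk_cov : covariance_on (@unit_cube R D) k)
  (hk_cont : {within @unit_cube R D `*` @unit_cube R D,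
                continuous (fun p => k p.1 p.2)})
  (hk_unit : forall T : 'I_d -> subdivision R, kernel_matrix k T \in unitmx)
  (hk_unit' : forall T : 'I_d.+1 -> subdivision R, kernel_matrix k T \in unitmx)
  (S : 'I_d -> subdivision R)
  (hfeas : feasible (ltnW hd) C x y S !=set0) :
  let S' := add_variable S in
  let alpha := mode_coef (ltnW hd) C k x y S in
  let alpha' := mode_coef hd C k x y S' in
  let Y := mode_fun (ltnW hd) C k x y S in
  let Y' := mode_fun hd C k x y S' in
  let beta := fun l : mindex S' => alpha (drop_last l) - alpha' l in
  (\int[lebesgue_tuple R d.+1]_(t in @tuple_row R d.+1 @^-1` @unit_cube R d.+1)
     ((Y (first_coords (leqnSn d) (tuple_row t)) - Y' (tuple_row t)) ^+ 2)%:E)%E =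
  (\sum_(l : mindex S') \sum_(l' : mindex S') beta l * Psi l l' * beta l')%:E.
Proof.
move=> S' alpha alpha' Y Y' beta.
have YE t : @unit_cube R d.+1 (tuple_row t) ->
    Y (first_coords (leqnSn d) (tuple_row t)) - Y' (tuple_row t) =
    interpolant [ffun l : mindex S' => beta l] (tuple_row t).
  move=> t01; rewrite /Y /mode_fun interpolant_add_variable // interpolantB.
  by congr interpolant; apply/ffunP => l; rewrite !ffunE.
under eq_integral => t /set_mem /= t01 do rewrite YE //.
rewrite integral_interpolant_sqr; congr EFin.
by apply: eq_bigr => l _; apply: eq_bigr => l' _; rewrite !ffunE.
Qed.
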